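(* Let $G$ be a hyperbolic group, with a finite generating set $S$, with a nonelementary action by isometries on a separable hyperbolic metric space $X$, let $x\in X$, and let $L>0$ be the drift constant of the action. For every $\epsilon>0$, $$\frac{\#\{g\in S_n : d_X(gx,x)\ge (L-\epsilon)|g|\}}{\#S_n}\to1\qquad\text{as } n\to\infty,$$ where $|g|$ is the word length of $g$ with respect to $S$ and $S_n=\{g\in G:|g|=n\}$.
   Context: A hyperbolic metric space is a geodesic metric space that is $\delta$-hyperbolic for some $\delta\ge0$; it is not assumed proper. The action is nonelementary if $G$ contains two loxodromic isometries of $X$ with disjoint fixed point sets in the Gromov boundary $\partial X$. Let $\lambda>1$ be the growth rate of $G$ with respect to $S$, i.e. the number such that $c^{-1}\lambda^n\le\#S_n\le c\lambda^n$ for some $c\ge1$ and all $n$. The Patterson--Sullivan measure $\nu$ on the Gromov boundary $\partial G$ is the weak limit (which exists), on $G\cup\partial G$, of $\nu_N=\big(\sum_{|g|\le N}\lambda^{-|g|}\delta_g\big)/\big(\sum_{|g|\le N}\lambda^{-|g|}\big)$ as $N\to\infty$. The drift constant $L>0$ is the constant (which exists and does not depend on $x$) such that for every $x\in X$, for $\nu$-almost every $\eta\in\partial G$ and every geodesic ray $(g_n)$ in $G$ converging to $\eta$, $\lim_{n\to\infty}d_X(x,g_nx)/n=L$. *)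

(* Defs.v *)
From HB Require Import structures.
From mathcomp Require Import all_boot all_order all_algebra finmap.
From mathcomp Require Import all_classical all_reals all_analysis.

Set Implicit Arguments.
Unset Strict Implicit.
Unset Printing Implicit Defensive.

Import Order.TTheory GRing.Theory Num.Theory.
Import numFieldNormedType.Exports.

Local Open Scope classical_set_scope.
Local Open Scope ring_scope.

(* The distance is a bare function [d], so that the same notions apply both to
   a [metricType] (through [mdist]) and to a group with a word metric, which
   depends on the generating set. *)
Section Hyperbolic.
Context {R : realType} {T : Type}.
Implicit Types (d : T -> T -> R) (u v : nat -> T).

Definition gromov_product d (w x y : T) : R := (d w x + d w y - d x y) / 2.

(* Gromov's four-point condition with constant [delta]. *)
Definition delta_hyperbolic d (delta : R) : Prop :=
  forall w x y z : T,
    Num.min (gromov_product d w x y) (gromov_product d w y z) - delta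
      <= gromov_product d w x z.

Definition hyperbolic d : Prop :=
  exists2 delta : R, 0 <= delta & delta_hyperbolic d delta.

(* (u_i | v_j)_w -> +oo as i, j -> oo. The condition does not depend on the
   base point w. *)
Definition product_diverges d u v : Prop :=
  forall w (A : R), \forall i & j \near \oo,
    A <= gromov_product d w (u i) (v j).

Definition converges_to_infinity d u : Prop := product_diverges d u u.

Definition boundary_class d u : set (nat -> T) :=
  [set v | converges_to_infinity d v /\ product_diverges d u v].

(* The Gromov boundary: equivalence classes of sequences converging to
   infinity. A sequence converges to xi exactly when it belongs to xi. *)
Definition boundary d : Type :=
  {xi : set (nat -> T) |
    exists2 u, converges_to_infinity d u & xi = boundary_class d u}.

Definition converges_to d u (xi : boundary d) : Prop := sval xi u.

(* Isometries act on the boundary by f [u] = [f \o u]. *)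
Definition boundary_fixed_points d (f : T -> T) : set (boundary d) :=
  [set xi | forall u, converges_to u xi -> converges_to (f \o u) xi].

End Hyperbolic.

Arguments boundary_fixed_points {R T} d f.

HB.instance Definition _ (R : realType) (T : Type) (d : T -> T -> R) :=
  gen_eqMixin (boundary d).
HB.instance Definition _ (R : realType) (T : Type) (d : T -> T -> R) :=
  gen_choiceMixin (boundary d).

Section MetricSpace.
Context {R : realType} (X : metricType R).

Definition separable_space : Prop := exists2 D : set X, countable D & dense D.

Definition geodesic_space : Prop :=
  forall x y : X, exists gamma : R -> X,
    [/\ gamma 0 = x, gamma (mdist x y) = y &
        forall s t, 0 <= s <= mdist x y -> 0 <= t <= mdist x y ->
          mdist (gamma s) (gamma t) = `|s - t|].

Definition hyperbolic_space : Prop :=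
  geodesic_space /\ hyperbolic (@mdist R X).

(* Positive translation length. *)
Definition loxodromic (f : X -> X) : Prop :=
  exists2 tau : R, 0 < tau &
    forall x, mdist x (iter n f x) / n%:R @[n --> \oo] --> tau.

Definition isometric_action (G : groupType) (a : G -> X -> X) : Prop :=
  [/\ forall x, a 1%g x = x,
      forall g h x, a (g * h)%g x = a g (a h x) &
      forall g x y, mdist (a g x) (a g y) = mdist x y].

Definition nonelementary (G : groupType) (a : G -> X -> X) : Prop :=
  exists g h : G,
    [/\ loxodromic (a g), loxodromic (a h) &
        boundary_fixed_points (@mdist R X) (a g) `&`
        boundary_fixed_points (@mdist R X) (a h) = set0].

End MetricSpace.

Section WordMetric.
Context {G : groupType} (S : set G).

Definition is_word_length_of (g : G) (n : nat) : Prop :=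
  exists w : seq G,
    [/\ size w = n, (forall s, s \in w -> S s \/ S s^-1%g) &
        (\prod_(s <- w) s)%g = g].

Definition generates : Prop := forall g, exists n, is_word_length_of g n.

(* The least length of a word in S and its inverses representing g (and the
   junk value 0 if there is none, which [generates] excludes). *)
Definition word_length (g : G) : nat :=
  xget 0%N [set n | is_word_length_of g n /\
                    forall m, is_word_length_of g m -> (n <= m)%N].

Definition word_sphere (n : nat) : set G := [set g | word_length g = n].

Definition word_ball (n : nat) : set G := [set g | (word_length g <= n)%N].

Definition word_dist (R : realType) (g h : G) : R :=
  (word_length (g^-1 * h)%g)%:R.

Definition hyperbolic_group (R : realType) : Prop := hyperbolic (word_dist R).

Definition geodesic_ray (r : nat -> G) : Prop :=
  forall m n, (m <= n)%N -> word_length ((r m)^-1 * r n)%g = (n - m)%N.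

Definition growth_rate (R : realType) (lambda : R) : Prop :=
  1 < lambda /\
  exists2 c : R, 1 <= c & forall n : nat,
    c^-1 * lambda ^+ n <= #|` fset_set (word_sphere n)|%:R
      <= c * lambda ^+ n.

End WordMetric.

Definition bordification (R : realType) (G : groupType) (S : set G) : Type :=
  (G + boundary (word_dist S R))%type.

Section Bordification.
Context {R : realType} {G : groupType} {S : set G}.
Local Notation B := (bordification R S).
Local Notation dG := (word_dist S R).

HB.instance Definition _ := Choice.copy B (G + boundary dG)%type.
HB.instance Definition _ := isPointed.Build B (inl 1%g).

(* The points of G or of the boundary whose Gromov product with xi, based at
   1, is at least r. *)
Definition boundary_nbhd (xi : boundary dG) (r : R) : set B :=
  [set z | match z with
    | inl g => exists2 u, converges_to u xi &
        \forall i \near \oo, r <= gromov_product dG 1%g (u i) g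
    | inr eta => exists u v, [/\ converges_to u xi, converges_to v eta &
        \forall i & j \near \oo, r <= gromov_product dG 1%g (u i) (v j)]
    end].

(* Points of G are isolated, and the sets [boundary_nbhd xi r] form a basis of
   neighborhoods of xi. *)
Definition bordification_open (U : set B) : Prop :=
  forall xi, U (inr xi) -> exists r, boundary_nbhd xi r `<=` U.

Lemma boundary_nbhd_le (xi : boundary dG) (r s : R) :
  r <= s -> boundary_nbhd xi s `<=` boundary_nbhd xi r.
Proof.
move=> rs [g [u xiu H]|eta [u [v [xiu etav H]]]] /=.
  exists u => //; apply: filterS H => i; exact: le_trans.
exists u, v; split=> //; apply: filterS H => -[i j] /=; exact: le_trans.
Qed.

Lemma bordification_openT : bordification_open setT.
Proof. by move=> xi _; exists 0. Qed.

Lemma bordification_openI : setI_closed bordification_open.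
Proof.
move=> U V oU oV xi [/oU[r rU] /oV[s sV]].
exists (Num.max r s) => z Hz; split.
  by apply: rU; apply: boundary_nbhd_le Hz; rewrite le_max lexx.
by apply: sV; apply: boundary_nbhd_le Hz; rewrite le_max lexx orbT.
Qed.

Lemma bordification_open_bigU (I : Type) (f : I -> set B) :
  (forall i, bordification_open (f i)) -> bordification_open (\bigcup_i f i).
Proof.
move=> of_ xi [i _ /of_[r rf]]; exists r => z /rf fz; by exists i.
Qed.

HB.instance Definition _ := isOpenTopological.Build B
  bordification_openT bordification_openI bordification_open_bigU.

End Bordification.

Notation borel_bordification R S :=
  (g_sigma_algebraType (@open (bordification R S))).

Section PattersonSullivan.
Context {R : realType} {G : groupType} (S : set G).
Local Notation B := (bordification R S).

(* The integral of f with respect to nu_N. *)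
Definition ball_average (lambda : R) (N : nat) (f : B -> R) : R :=
  (\sum_(g \in word_ball S N) lambda ^- word_length S g * f (inl g)) /
  (\sum_(g \in word_ball S N) lambda ^- word_length S g).

(* nu is carried by the boundary, and is the weak limit of the nu_N. *)
Definition patterson_sullivan (lambda : R)
    (nu : probability (borel_bordification R S) R) : Prop :=
  nu (range inl) = 0%E /\
  forall f : B -> R, continuous f -> (exists M, forall z, `|f z| <= M) ->
    ball_average lambda N f @[N --> \oo] --> (\int[nu]_z f z : R).

Definition drift_constant (X : metricType R) (a : G -> X -> X)
    (nu : probability (borel_bordification R S) R) (L : R) : Prop :=
  0 < L /\
  forall x : X, {ae nu, forall z : B, forall eta, z = inr eta ->
    forall r : nat -> G, geodesic_ray S r -> converges_to r eta ->
      mdist x (a (r n) x) / n%:R @[n --> \oo] --> L}.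

End PattersonSullivan.

(* Main.v *)
(* Call z a member of the shadow of g in S_n when the Gromov product (z|g) is at
   least n - k. Since the growth is exactly exponential, for k large at least half
   of the h in each sphere satisfy (g^-1|h) < k, and then gh lies in the shadow of
   g; hence the shadow of g has nu_N-mass at least a constant times lambda^-n as
   soon as N >= 2n. Elements of S_n whose shadows meet are at bounded distance, so
   a set A of elements of S_n has #A / #S_n bounded by a constant times the
   nu_N-mass of the union of its shadows. Let A = A_n be the set of g in S_n with
   d(gx, x) < (L - eps) n, and let f_n be a continuous function with values in
   [0, 1], equal to 1 on the union of the shadows of A_n and to 0 off slightly
   larger shadows. Letting N tend to infinity, #A_n / #S_n is bounded by a constant
   times the nu-integral of f_n. If xi is in a larger shadow of g in A_n, then a
   geodesic ray from 1 to xi passes at bounded distance from g at time n, so the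
   drift along this ray up to time n is too small. For nu-almost every xi this
   happens for finitely many n only, and dominated convergence concludes. *)

Require Import Defs.
From HB Require Import structures.
From mathcomp Require Import all_boot all_order all_algebra finmap.
From mathcomp Require Import all_classical all_reals all_analysis.
From mathcomp Require Import ring lra zify.

Set Implicit Arguments.
Unset Strict Implicit.
Unset Printing Implicit Defensive.

Import Order.TTheory GRing.Theory Num.Theory.
Import numFieldNormedType.Exports.

Local Open Scope classical_set_scope.
Local Open Scope ring_scope.

(** * Word length *)

Section WordLength.
Context {G : groupType} {S : set G}.
Hypotheses (finS : finite_set S) (genS : generates S).
Local Notation len := (word_length S).

Lemma word_length_min (g : G) :
  is_word_length_of S g (len g) /\
  forall m, is_word_length_of S g m -> (len g <= m)%N.
Proof.
apply: (xgetPex 0%N (P := [set n | is_word_length_of S g n /\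
  forall m, is_word_length_of S g m -> (n <= m)%N])).
have [n /asboolP gn] := genS g.
have ex : exists n, `[< is_word_length_of S g n >] by exists n.
exists (ex_minn ex); case: ex_minnP => m /asboolP gm min; split=> // p gp.
by apply: min; apply/asboolP.
Qed.

Lemma word_length_le (g : G) (m : nat) :
  is_word_length_of S g m -> (len g <= m)%N.
Proof. by have [_] := word_length_min g; apply. Qed.

Lemma word_length1 : len 1%g = 0%N.
Proof.
apply/eqP; rewrite -leqn0; apply: word_length_le.
by exists [::]; split=> //; rewrite big_nil.
Qed.

Lemma word_lengthM (g h : G) : (len (g * h)%g <= len g + len h)%N.
Proof.
have [[u [su Su ug]] _] := word_length_min g.
have [[v [sv Sv vh]] _] := word_length_min h.
apply: word_length_le; exists (u ++ v).
split; [by rewrite size_cat su sv| |by rewrite big_cat /= ug vh].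
by move=> s; rewrite mem_cat => /orP[/Su|/Sv].
Qed.

Lemma word_lengthV_le (g : G) : (len g^-1%g <= len g)%N.
Proof.
have [[w [sw Sw wg]] _] := word_length_min g.
apply: word_length_le; exists (rev [seq s^-1%g | s <- w]).
split; [by rewrite size_rev size_map sw| |].
  move=> s; rewrite mem_rev => /mapP[t /Sw tS ->].
  by case: tS; [right; rewrite invgK|left].
by rewrite -map_rev big_map prodgV revK wg.
Qed.

Lemma word_lengthV (g : G) : len g^-1%g = len g.
Proof.
apply/eqP; rewrite eqn_leq word_lengthV_le /=.
by rewrite -{1}(invgK g) word_lengthV_le.
Qed.

Lemma word_length_eq0 (g : G) : len g = 0%N -> g = 1%g.
Proof.
move=> g0; have [[w [/eqP]]] := word_length_min g.
by rewrite g0 size_eq0 => /eqP -> _; rewrite big_nil.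
Qed.

(** [p] runs through the prefixes of a shortest word. The pieces before, between and after two cuts
    have at most the expected lengths, and the triangle inequality for [g] turns these bounds into
    equalities. *)
Lemma word_geodesic (g : G) : exists p : nat -> G,
  forall m n, (m <= n <= len g)%N -> len ((p m)^-1 * p n)%g = (n - m)%N /\
    len (p m) = m /\ len ((p m)^-1 * g)%g = (len g - m)%N.
Proof.
have [[w [sw Sw wg]] _] := word_length_min g.
pose p n := (\prod_(s <- take n w) s)%g.
have lenw (v : seq G) : {subset v <= w} -> (len (\prod_(s <- v) s)%g <= size v)%N.
  by move=> vw; apply: word_length_le; exists v; split=> // s /vw /Sw.
have p_le n : (len (p n) <= n)%N.
  apply: leq_trans (lenw _ _) _; first exact: mem_take.
  by rewrite size_take; case: ltnP.
have tail n : ((p n)^-1 * g = \prod_(s <- drop n w) s)%g.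
  by rewrite -wg -{1}(cat_take_drop n w) big_cat /= mulKg.
have tail_le n : (len ((p n)^-1 * g)%g <= len g - n)%N.
  rewrite tail -sw -size_drop; apply: lenw => s; exact: mem_drop.
have mid m n : (m <= n)%N -> (len ((p m)^-1 * p n)%g <= n - m)%N.
  move=> mn; have -> : ((p m)^-1 * p n = \prod_(s <- drop m (take n w)) s)%g.
    have e : take n w = take m w ++ drop m (take n w).
      by rewrite -{1}(cat_take_drop m (take n w)) take_takel.
    by rewrite /p {1}e big_cat /= mulKg.
  apply: leq_trans (lenw _ _) _; first by move=> s /mem_drop/mem_take.
  by rewrite size_drop leq_sub2r// size_take; case: ltnP.
have tri x y : (len g <= len x + len (x^-1 * y) + len (y^-1 * g))%N.
  have {1}-> : (g = x * (x^-1 * y * (y^-1 * g)))%g.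
    by rewrite !mulgA mulgV mul1g mulgV mul1g.
  rewrite -addnA; apply: leq_trans (word_lengthM _ _) _.
  by rewrite leq_add2l word_lengthM.
exists p => m n /andP[mn ng].
have := tri (p m) (p n); have := p_le m; have := mid _ _ mn.
have := tail_le n; have := tri (p m) (p m); rewrite mulVg word_length1 addn0.
have := tail_le m; lia.
Qed.

Lemma finite_word_ball (n : nat) : finite_set (word_ball S n).
Proof.
have finE : finite_set (S `|` [set s | S s^-1%g]).
  rewrite finite_setU; split=> //.
  have -> : [set s | S s^-1%g] = monoid.inv @` S.
    rewrite eqEsubset; split=> s /=; first by exists s^-1%g; rewrite ?invgK.
    by move=> [t St <-]; rewrite /= invgK.
  exact: finite_image.
have fin k : finite_set [set g | is_word_length_of S g k].
  elim: k => [|k IH].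
    apply: sub_finite_set (finite_set1 1%g) => g [w [/eqP]].
    by rewrite size_eq0 => /eqP -> _ <-; rewrite big_nil.
  apply: sub_finite_set (finite_image2 *%g finE IH).
  move=> g [[|s w] []] //= [sw] Sw <-; exists s; first exact: Sw (mem_head _ _).
  exists (\prod_(t <- w) t)%g; last by rewrite big_cons.
  by exists w; split=> // t tw; apply: Sw; rewrite inE tw orbT.
elim: n => [|n IH].
  apply: sub_finite_set (finite_set1 1%g) => g /=.
  by rewrite /word_ball /= leqn0 => /eqP/word_length_eq0.
apply: (@sub_finite_set _ _ (word_ball S n `|` [set g | is_word_length_of S g n.+1])).
  move=> g; rewrite /word_ball /= leq_eqVlt ltnS => /orP[/eqP <-|]; last by left.
  by right; have [] := word_length_min g.
by rewrite finite_setU.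
Qed.

Lemma finite_word_sphere (n : nat) : finite_set (word_sphere S n).
Proof.
by apply: sub_finite_set (finite_word_ball n) => g; rewrite /word_ball/= => ->.
Qed.

Lemma word_ball0 : word_ball S 0 = word_sphere S 0.
Proof.
by rewrite eqEsubset; split=> g /=; rewrite /word_ball /word_sphere /= leqn0 => /eqP.
Qed.

Lemma word_ballS (n : nat) : word_ball S n.+1 = word_ball S n `|` word_sphere S n.+1.
Proof.
rewrite eqEsubset; split=> g; rewrite /word_ball /word_sphere /=.
  by rewrite leq_eqVlt ltnS => /orP[/eqP|]; [right|left].
by case=> [/leqW //|->].
Qed.

End WordLength.

(** * Gromov products and growth *)

Lemma sum_fset_le (R : realDomainType) (T : choiceType) (A B : {fset T})
    (F : T -> R) : {subset A <= B} ->
  (forall x, x \in B -> 0 <= F x) -> \sum_(x <- A) F x <= \sum_(x <- B) F x.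
Proof.
move=> AB F0; rewrite (big_fsetID _ (mem A) B) /=.
have -> : [fset x in B | x \in A]%fset = A.
  apply/fsetP => x; rewrite !inE /= andbC.
  by case: (boolP (x \in A)) => // /AB ->.
rewrite lerDl big_seq; apply: sumr_ge0 => x; rewrite !inE /=.
by move=> /andP[/F0].
Qed.

Lemma card_fset_set_le (T : choiceType) (A B : set T) : finite_set B -> A `<=` B ->
  (#|` fset_set A| <= #|` fset_set B|)%N.
Proof.
move=> finB AB; apply: fsubset_leq_card; rewrite -fset_set_sub //.
exact: sub_finite_set finB.
Qed.

Lemma card_fset_set_image (T U : choiceType) (f : T -> U) (A : set T) :
  finite_set A -> (#|` fset_set (f @` A)| <= #|` fset_set A|)%N.
Proof. by move=> finA; rewrite fset_set_image // leq_imfset_card. Qed.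

Section GromovProduct.
Context {R : realType} {G : groupType} {S : set G}.
Hypothesis (genS : generates S).
Local Notation len := (word_length S).
Local Notation "g ** h" := (gromov_product (word_dist S R) 1%g g h)
  (at level 40).

Lemma word_productE (g h : G) :
  g ** h = ((len g)%:R + (len h)%:R - (len (g^-1 * h)%g)%:R) / 2.
Proof. by rewrite /gromov_product /word_dist invg1 !mul1g. Qed.

Lemma word_distC (g h : G) : len (g^-1 * h)%g = len (h^-1 * g)%g.
Proof. by rewrite -(word_lengthV genS (g^-1 * h)%g) invgM invgK. Qed.

Lemma word_productC (g h : G) : g ** h = h ** g.
Proof. by rewrite !word_productE (word_distC g h); lra. Qed.

Lemma word_product_lel (g h : G) : g ** h <= (len g)%:R.
Proof.
have := word_lengthM genS g (g^-1 * h)%g; rewrite mulVKg word_productE.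
by rewrite -(ler_nat R) natrD; lra.
Qed.

Lemma word_product_ler (g h : G) : g ** h <= (len h)%:R.
Proof. by rewrite word_productC word_product_lel. Qed.

Lemma word_product_self (g : G) : g ** g = (len g)%:R.
Proof. by rewrite word_productE mulVg (word_length1 genS); lra. Qed.

Lemma word_product_geodesic (p g : G) :
  (len p <= len g)%N -> len (p^-1 * g)%g = (len g - len p)%N ->
  p ** g = (len p)%:R.
Proof. by move=> pg e; rewrite word_productE e natrB //; lra. Qed.

Lemma word_product_dist (g h : G) (n k : nat) (r : R) :
  len g = n -> len h = n -> n%:R - r <= g ** h -> r *+ 2 <= k%:R ->
  (len (g^-1 * h)%g <= k)%N.
Proof.
rewrite word_productE => -> -> H rk; rewrite -(ler_nat R).
by rewrite -mulr_natl in rk; lra.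
Qed.

Context (delta : R).
Hypothesis (hypG : delta_hyperbolic (word_dist S R) delta).

Lemma word_product_trans (r : R) (x y z : G) :
  r <= x ** y -> r <= y ** z -> r - delta <= x ** z.
Proof.
move=> rx ry; apply: le_trans (hypG 1%g x y z).
by rewrite lerD2r le_min rx ry.
Qed.

End GromovProduct.

Section Growth.
Context {R : realType} {G : groupType} {S : set G}.
Hypotheses (finS : finite_set S) (genS : generates S).
Context (lambda c : R).
Hypotheses (lambda1 : 1 < lambda) (c1 : 1 <= c).
Hypothesis growth : forall n : nat,
  c^-1 * lambda ^+ n <= #|` fset_set (word_sphere S n)|%:R <= c * lambda ^+ n.
Local Notation len := (word_length S).
Local Notation "g ** h" := (gromov_product (word_dist S R) 1%g g h)
  (at level 40).

Let lambda0 : 0 < lambda. Proof. exact: lt_trans ltr01 lambda1. Qed.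
Let c0 : 0 < c. Proof. exact: lt_le_trans ltr01 c1. Qed.
Let lamX n : 0 < lambda ^+ n. Proof. exact: exprn_gt0. Qed.

Lemma word_ball_growth (n : nat) :
  #|` fset_set (word_ball S n)|%:R <= c * lambda / (lambda - 1) * lambda ^+ n.
Proof.
have l1 : 0 < lambda - 1 by rewrite subr_gt0.
set K := c * lambda / _.
(* [K] is the fixed point of this recursion, so the bound at [n] plus that of the next sphere gives
   exactly the bound at [n.+1]. *)
have KE : K = K / lambda + c.
    by rewrite /K; field; rewrite subr_eq0 !gt_eqF.
elim: n => [|n IH].
  rewrite word_ball0; have /andP[_ H] := growth 0; apply: le_trans H _.
  rewrite ler_pM2r // KE lerDr divr_ge0 ?(ltW lambda0) //.
  by rewrite divr_ge0 ?mulr_ge0 ?ltW.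
rewrite word_ballS fset_setU; [|exact: finite_word_ball|exact: finite_word_sphere].
apply: (@le_trans _ _ (K * lambda ^+ n + c * lambda ^+ n.+1)).
  have /andP[_ H] := growth n.+1; apply: le_trans (lerD IH H).
  by rewrite -natrD ler_nat cardfsU leq_subr.
by rewrite {2}KE mulrDl lerD2r exprS mulrA divfK // gt_eqF.
Qed.

Lemma sum_word_ball (F : G -> R) (n : nat) :
  \sum_(g <- fset_set (word_ball S n)) F g =
  \sum_(m < n.+1) \sum_(g <- fset_set (word_sphere S m)) F g.
Proof.
elim: n => [|n IH]; first by rewrite big_ord1 word_ball0.
rewrite big_ord_recr /= -IH.
rewrite -!fsbig_finite; try exact: finite_word_ball; try exact: finite_word_sphere.
rewrite word_ballS fsbigU0 //; [exact: finite_word_ball|exact: finite_word_sphere|].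
by move=> g []; rewrite /word_ball /word_sphere /= => + gn; rewrite gn ltnn.
Qed.

Lemma sphere_weight (n : nat) (F : G -> R) (b : R) : (forall g, len g = n -> F g = b) ->
  \sum_(g <- fset_set (word_sphere S n)) F g = b *+ #|` fset_set (word_sphere S n)|.
Proof.
move=> Fb; rewrite big_seq (eq_bigr (fun=> b)); last first.
  move=> g; rewrite in_fset_set ?inE; last exact: finite_word_sphere.
  exact: Fb.
by rewrite -big_seq big_const_seq count_predT iter_addr_0.
Qed.

(** Each sphere has weight at most [c], so the normalizing constants of the ball averages grow at
    most linearly. *)
Lemma ball_weight_le (n : nat) :
  \sum_(g <- fset_set (word_ball S n)) lambda ^- len g <= c * n.+1%:R.
Proof.
rewrite sum_word_ball mulr_natr -[X in _ *+ X]card_ord -sumr_const.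
apply: ler_sum => m _; rewrite (@sphere_weight m _ (lambda ^- m)); last by move=> g ->.
have /andP[_ H] := growth m.
by rewrite -mulr_natr mulrC ler_pdivrMr.
Qed.

Lemma ball_weight_gt0 (n : nat) :
  0 < \sum_(g <- fset_set (word_ball S n)) lambda ^- len g.
Proof.
rewrite sum_word_ball big_ord_recl /= (@sphere_weight 0 _ 1); last first.
  by move=> g ->; rewrite expr0 invr1.
apply: ltr_wpDr; last first.
  have /andP[H _] := growth 0; apply: lt_le_trans H.
  by rewrite mulr1 invr_gt0.
by apply: sumr_ge0 => i _; apply: sumr_ge0 => g _; rewrite invr_ge0 ltW.
Qed.

End Growth.

(** * Shadows in the group *)

Section Shadows.
Context {R : realType} {G : groupType} {S : set G}.
Hypotheses (finS : finite_set S) (genS : generates S).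
Context (delta : R) (D : nat).
Hypothesis hypG : delta_hyperbolic (word_dist S R) delta.
Hypothesis deltaD : delta *+ 2 <= D%:R.
Context (lambda c : R).
Hypotheses (lambda1 : 1 < lambda) (c1 : 1 <= c).
Hypothesis growth : forall n : nat,
  c^-1 * lambda ^+ n <= #|` fset_set (word_sphere S n)|%:R <= c * lambda ^+ n.
Local Notation len := (word_length S).
Local Notation "g ** h" := (gromov_product (word_dist S R) 1%g g h)
  (at level 40).
Local Notation ball n := (fset_set (word_ball S n)).
Local Notation sphere n := (fset_set (word_sphere S n)).

Let lambda0 : 0 < lambda. Proof. exact: lt_trans ltr01 lambda1. Qed.
Let c0 : 0 < c. Proof. exact: lt_le_trans ltr01 c1. Qed.
Let lamX n : 0 < lambda ^+ n. Proof. exact: exprn_gt0. Qed.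

Lemma in_word_ball g n : (g \in ball n) = (len g <= n)%N.
Proof.
rewrite in_fset_set; last exact: finite_word_ball.
by apply/idP/idP; rewrite inE.
Qed.

Lemma in_word_sphere g n : (g \in sphere n) = (len g == n).
Proof.
rewrite in_fset_set; last exact: finite_word_sphere.
by apply/idP/eqP; rewrite inE.
Qed.

(* If [h] shares with [g] the initial piece [p] of length [k], then [p^-1 h] has
   length at most [m - k] up to a constant. *)
Lemma card_fellow_travelers : exists k : nat, forall (g : G) (m : nat),
  #|` fset_set [set h | word_sphere S m h /\ k%:R <= g ** h]|%:R
    <= (2 * c)^-1 * lambda ^+ m.
Proof.
pose K := c * lambda / (lambda - 1) * lambda ^+ D.
have K0 : 0 < K by rewrite !mulr_gt0 ?invr_gt0 ?subr_gt0.
have e0 : 0 < (2 * c)^-1 / K by rewrite divr_gt0 // invr_gt0 mulr_gt0.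
(* This [k] makes [K * lambda ^+ m * lambda ^- k] at most half of the lower bound
   [c^-1 * lambda ^+ m] for a sphere. *)
have [k Hk] : exists k, lambda ^- k <= (2 * c)^-1 / K.
  have lV : `|lambda^-1| < 1.
    by rewrite ger0_norm ?invr_ge0 ?(ltW lambda0) // invf_lt1.
  have /cvgr0_norm_le /(_ _ e0)[k _ /(_ k (leqnn k))] := cvg_expr lV.
  by rewrite /= exprVn ger0_norm ?invr_ge0 ?(ltW (lamX k)) // => H; exists k.
exists k => g m; set A := [set h | _].
(* An element of [A] forces [k <= m] and [k <= len g], so [m - k] is not truncated and [p k] is on
   the geodesic to [g]. *)
have [->|/set0P[h0 [m0 kh0]]] := eqVneq A set0.
  by rewrite fset_set0 cardfs0 mulr_ge0 ?invr_ge0 ?ltW // mulr_gt0.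
have km : (k <= m)%N.
  rewrite -(ler_nat R); apply: le_trans kh0 _.
  by rewrite -m0; exact: word_product_ler.
have kg : (k <= len g)%N.
  by rewrite -(ler_nat R); apply: le_trans kh0 _; exact: word_product_lel.
have [p Hp] := word_geodesic genS g.
have [_ [pk pg]] := Hp k k (introT andP (conj (leqnn k) kg)).
have Asub : A `<=` *%g (p k) @` word_ball S (m - k + D).
  move=> h [hm kh]; exists ((p k)^-1 * h)%g; last by rewrite mulVKg.
  have kpg : k%:R <= p k ** g.
    by rewrite word_product_geodesic ?pk.
  have := word_product_trans hypG kpg kh.
  rewrite word_productE pk hm /word_ball /= -(ler_nat R) natrD natrB //.
  by move: deltaD; rewrite -mulr_natl; lra.
apply: (@le_trans _ _ #|` ball (m - k + D)|%:R).
  rewrite ler_nat; apply: leq_trans (card_fset_set_image ( *%g (p k)) _).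
    apply: card_fset_set_le Asub.
    by apply: finite_image; exact: finite_word_ball.
  exact: finite_word_ball.
apply: le_trans (word_ball_growth finS genS lambda1 c1 growth _) _.
have -> : c * lambda / (lambda - 1) * lambda ^+ (m - k + D) =
    K * lambda ^+ m * lambda ^- k.
  rewrite -{2}(subnK km) !exprD /K; field.
  by rewrite !gt_eqF ?subr_gt0.
rewrite mulrAC ler_pM2r //.
by move: Hk; rewrite ler_pdivlMr // mulrC.
Qed.

Context (k : nat).
Hypothesis few : forall (g : G) (m : nat),
  #|` fset_set [set h | word_sphere S m h /\ k%:R <= g ** h]|%:R
    <= (2 * c)^-1 * lambda ^+ m.

(** The elements [g * h] with [g^-1 ** h < k] and [len h <= N - n] lie in the shadow. Each of the
    [N - n + 1] spheres of such [h] contributes at least [(2 * c)^-1 * lambda ^- n]. *)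
Lemma shadow_weight (g : G) (n N : nat) : len g = n -> (n <= N)%N ->
  (2 * c)^-1 * lambda ^- n * (N - n).+1%:R <=
  \sum_(z <- ball N | n%:R - k%:R <= z ** g) lambda ^- len z.
Proof.
move=> gn nN.
pose good h := g^-1%g ** h < k%:R.
pose A := [fset (g * h)%g | h in [fset h in ball (N - n) | good h]]%fset.
pose Z := [fset z in ball N | n%:R - k%:R <= z ** g]%fset.
rewrite big_fset_condE /= -/Z; apply: (@le_trans _ _ (\sum_(z <- A) lambda ^- len z)).
  rewrite big_imfset /=; last by move=> h h' _ _ /mulgI.
  rewrite -big_fset_condE.
  apply: (@le_trans _ _ (\sum_(h <- ball (N - n) | good h) lambda ^- (n + len h))).
    rewrite big_mkcond /= sum_word_ball // mulr_natr -[X in _ *+ X]card_ord -sumr_const.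
    apply: ler_sum => m _; rewrite -big_mkcond.
    have := @sphere_weight R G S finS genS m (fun h => lambda ^- (n + len h))
      (lambda ^- (n + m)) (fun h => @congr1 _ _ (fun i => lambda ^- (n + i)) (len h) m).
    rewrite (bigID good) /= => tot.
    (* By [few], the discarded [h] use up at most half of the guaranteed weight [c^-1 * lambda ^- n]
       of the sphere. *)
    have bad : \sum_(h <- sphere m | ~~ good h) lambda ^- (n + len h) <=
        (2 * c)^-1 * lambda ^- n.
      rewrite big_fset_condE /=; set B := (X in enum_fset X).
      have -> : B = fset_set [set h | word_sphere S m h /\ k%:R <= g^-1%g ** h].
        apply/fsetP => h; rewrite !inE /= in_word_sphere in_fset_set; last first.
          by apply: sub_finite_set (finite_word_sphere finS genS m) => h' [].
        rewrite /good -leNgt; apply/andP/idP => [[/eqP]|].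
          by rewrite inE.
        by rewrite inE => -[] /= <-.
      rewrite big_seq (eq_bigr (fun=> lambda ^- (n + m))); last first.
        move=> h; rewrite in_fset_set; last first.
          by apply: sub_finite_set (finite_word_sphere finS genS m) => h' [].
        by rewrite inE => -[->].
      rewrite -big_seq big_const_seq count_predT iter_addr_0 -[leLHS]mulr_natl.
      rewrite exprD invfM mulrCA [leRHS]mulrC ler_pM2l ?invr_gt0 //.
      by rewrite ler_pdivrMr.
    have : c^-1 * lambda ^- n <= lambda ^- (n + m) *+ #|` sphere m|.
      rewrite -mulr_natl exprD invfM mulrCA [leLHS]mulrC ler_pM2l ?invr_gt0 //.
      by rewrite ler_pdivlMr //; case/andP: (growth m).
    have -> : c^-1 = (2 * c)^-1 *+ 2 by rewrite -mulr_natr; field; rewrite gt_eqF.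
    by rewrite -tot mulrnAl mulr2n; lra.
  (* Since [len (g * h) <= n + len h], the true weight of [g * h] is at least the one counted. *)
  apply: ler_sum => h _.
  rewrite lef_pV2 ?posrE // ler_weXn2l ?(ltW lambda1) //.
  by rewrite -gn word_lengthM.
apply: sum_fset_le => [z|z _]; last by rewrite invr_ge0 ltW.
move=> /imfsetP[h /=]; rewrite !inE /= in_word_ball => /andP[hN gh] ->.
rewrite in_word_ball; apply/andP; split.
  by apply: leq_trans (word_lengthM genS g h) _; rewrite gn -leq_subRL.
(* The products of [g^-1] with [h] and of [g * h] with [g] add up to [n]. *)
move: gh; rewrite /good !word_productE // invgK (word_lengthV genS) gn.
rewrite (word_distC genS (g * h)%g) mulKg; lra.
Qed.

(** Hyperbolicity at [z] puts all these [g] within distance [2 * k + D] of one of them. The boolean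
    factor is the indicator of the union of the shadows. *)
Lemma shadow_overlap (A : {fset G}) (n : nat) (z : G) : {in A, forall g, len g = n} ->
  (#|` [fset g in A | (n%:R - k%:R <= z ** g)%R]%fset| <=
   #|` ball (2 * k + D)| *
   `[< exists2 g, g \in A & (n%:R - k%:R <= z ** g)%R >])%N.
Proof.
move=> An; case: asboolP => [[g0 g0A zg0]|no]; last first.
  rewrite muln0 leqn0 cardfs_eq0; apply/eqP/fsetP => g; rewrite !inE /=.
  by apply/negP => /andP[gA zg]; apply: no; exists g.
rewrite muln1; apply: (@leq_trans #|` [fset (g0 * h)%g | h in ball (2 * k + D)]%fset|).
  apply: fsubset_leq_card; apply/fsubsetP => g; rewrite !inE /= => /andP[gA zg].
  apply/imfsetP; exists (g0^-1 * g)%g; last by rewrite mulVKg.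
  rewrite /= in_word_ball.
  apply: (@word_product_dist R _ _ _ _ n _ (k%:R + delta)); [exact: An|exact: An| |].
    rewrite opprD addrA; apply: (word_product_trans hypG (y := z)) => //.
    by rewrite word_productC.
  by rewrite mulrnDl natrD natrM mulr_natl lerD2l.
exact: leq_imfset_card.
Qed.

(** Double counting of the pairs of a [g] in [A] and a [z] in its shadow: [shadow_weight] bounds the
    sum below for each [g], [shadow_overlap] bounds it above for each [z]. *)
Lemma shadow_union_weight (A : {fset G}) (n N : nat) :
  {in A, forall g, len g = n} -> (n <= N)%N ->
  #|` A|%:R * ((2 * c)^-1 * lambda ^- n * (N - n).+1%:R) <=
  #|` ball (2 * k + D)|%:R *
    \sum_(z <- ball N | `[< exists2 g, g \in A & n%:R - k%:R <= z ** g >])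
      lambda ^- len z.
Proof.
move=> An nN.
apply: (@le_trans _ _ (\sum_(g <- A) \sum_(z <- ball N | n%:R - k%:R <= z ** g)
    lambda ^- len z)).
  rewrite mulr_natl -[X in _ *+ X]count_predT -iter_addr_0 -big_const_seq.
  by rewrite big_seq [leRHS]big_seq; apply: ler_sum => g /An gn; exact: shadow_weight.
under eq_bigr do rewrite big_mkcond.
rewrite exchange_big /= mulr_sumr [leRHS]big_mkcond /=; apply: ler_sum => z _.
rewrite -big_mkcond big_fset_condE big_const_seq count_predT iter_addr_0 /=.
have := shadow_overlap z An; case: asboolP => _; rewrite ?muln1 ?muln0 => H.
  by rewrite -[leLHS]mulr_natl ler_pM2r ?invr_gt0 // ler_nat.
by move: H; rewrite leqn0 => /eqP ->.
Qed.

End Shadows.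

(** * Boundary and geodesic rays *)

Lemma near_infty2 (P : nat -> nat -> Prop) :
  (\forall i & j \near \oo, P i j) <->
  exists N, forall i j, (N <= i)%N -> (N <= j)%N -> P i j.
Proof.
split=> [[[A B] /= [[M _ MA] [N _ NB]] AB]|[N HN]].
  exists (maxn M N) => i j; rewrite !geq_max => /andP[Mi _] /andP[_ Nj].
  by apply: (AB (i, j)); split; [exact: MA|exact: NB].
by exists ([set i | (N <= i)%N], [set i | (N <= i)%N]) => [|[i j] [/=]];
  [split; exists N|exact: HN].
Qed.

Lemma near_infty1 (P : nat -> Prop) :
  (\forall i \near \oo, P i) <-> exists N, forall i, (N <= i)%N -> P i.
Proof. by split=> [[N _ HN]|[N HN]]; exists N. Qed.

(** This takes the place of a diagonal extraction of subsequences in the construction of rays. *)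
Lemma ultra_pigeonhole (T : Type) (U : choiceType) (F : set_system T)
  (f : T -> U) (A : set U) : UltraFilter F -> finite_set A ->
  F (f @^-1` A) -> exists a, F (f @^-1` [set a]).
Proof.
move=> UF finA FA; apply: contrapT => no.
have FC a : a \in fset_set A -> F (f @^-1` (~` [set a])).
  by move=> _; have [H|//] := in_ultra_setVsetC (f @^-1` [set a]) UF; case: no; exists a.
have PF := @ultra_proper _ _ UF.
have FB := @filter_bigI _ _ _ _ _ PF FC.
have /filter_ex[x [/= Ax]] := @filterI _ _ PF _ _ FA FB.
by move/(_ (f x)); rewrite /= in_fset_set // inE => /(_ Ax); exact.
Qed.

Section Bordification.
Context {R : realType} {G : groupType} {S : set G}.
Hypotheses (genS : generates S).
Context (delta : R).
Hypothesis delta0 : 0 <= delta.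
Hypothesis hypG : delta_hyperbolic (word_dist S R) delta.
Local Notation len := (word_length S).
Local Notation "g ** h" := (gromov_product (word_dist S R) 1%g g h)
  (at level 40).
Local Notation B := (bordification R S).

(** Moving the base point from 1 to [w] lowers a Gromov product by at most [len w]. *)
Lemma product_divergesP (u v : nat -> G) : product_diverges (word_dist S R) u v <->
  forall A, exists N, forall i j, (N <= i)%N -> (N <= j)%N -> A <= u i ** v j.
Proof.
split=> [H A|H w A]; first exact/near_infty2.
have [N HN] := H (A + (len w)%:R).
apply/near_infty2; exists N => i j Ni Nj; have := HN i j Ni Nj.
rewrite word_productE /gromov_product /word_dist.
have := word_lengthM genS w (w^-1 * u i)%g; have := word_lengthM genS w (w^-1 * v j)%g.
by rewrite !mulVKg -!(ler_nat R) !natrD; lra.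
Qed.

(** Constant sequences for the points of [G] let both kinds of points be treated by the same
    estimates. *)
Definition represents (z : B) (u : nat -> G) : Prop :=
  match z with inl g => u = cst g | inr xi => converges_to u xi end.

Lemma represents_ex (z : B) : exists u, represents z u.
Proof.
case: z => [g|[xi [u uinf xiE]]]; first by exists (cst g).
by exists u; rewrite /= /converges_to /= xiE; split.
Qed.

Lemma product_diverges_sym (u v : nat -> G) :
  product_diverges (word_dist S R) u v -> product_diverges (word_dist S R) v u.
Proof.
move=> /product_divergesP H; apply/product_divergesP => A.
have [N HN] := H A; exists N => i j Ni Nj.
by rewrite word_productC //; exact: HN.
Qed.

Lemma product_diverges_trans (u v w : nat -> G) :
  product_diverges (word_dist S R) u v -> product_diverges (word_dist S R) v w ->
  product_diverges (word_dist S R) u w.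
Proof.
move=> /product_divergesP uv /product_divergesP vw; apply/product_divergesP => A.
have [M HM] := uv (A + delta); have [N HN] := vw (A + delta).
exists (maxn M N) => i j; rewrite !geq_max => /andP[Mi Ni] /andP[Mj Nj].
rewrite -(addrK delta A).
apply: (word_product_trans hypG (y := v (maxn M N))).
  by apply: HM; rewrite // leq_maxl.
by apply: HN; rewrite // leq_maxr.
Qed.

Lemma converges_to_trans (xi : boundary (word_dist S R)) (u v : nat -> G) :
  converges_to u xi -> converges_to v xi -> product_diverges (word_dist S R) u v.
Proof.
case: xi => xi [w winf xiE]; rewrite /converges_to /= xiE => -[_ wu] [_ wv].
by apply: (product_diverges_trans (v := w)) => //; exact: product_diverges_sym.
Qed.

(** Two representatives of [z] have large mutual products, so hyperbolicity applied twice, through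
    [u i] and then [v i], leads from [x] to [y]. For [z] in [G] one application suffices. *)
Lemma represents_trans (z : B) (u v : nat -> G) (N : nat) (r : R) (x y : G) :
  represents z u -> represents z v ->
  (forall i, (N <= i)%N -> r <= x ** u i) ->
  (forall i, (N <= i)%N -> r <= v i ** y) -> r - delta *+ 2 <= x ** y.
Proof.
case: z => [g|xi] /= zu zv xu vy.
  have := xu N (leqnn N); have := vy N (leqnn N); rewrite {}zu {}zv /= => gy xg.
  apply: le_trans (word_product_trans hypG xg gy).
  by rewrite lerD2l lerN2 mulr2n lerDl.
have /product_divergesP/(_ r)[M HM] := converges_to_trans zu zv.
pose i := maxn M N.
have uv : r <= u i ** v i by apply: HM; rewrite leq_maxl.
have xv := word_product_trans hypG (xu i (leq_maxr _ _)) uv.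
rewrite mulr2n opprD addrA.
apply: (word_product_trans hypG xv).
by apply: le_trans (vy i (leq_maxr _ _)); rewrite lerBlDr lerDl.
Qed.

(** The equality clause makes the relation reflexive: a point [g] of the group has product only
    [len g] with itself. *)
Definition close (r : R) : set (B * B) :=
  [set zw | zw.1 = zw.2 \/ exists u v, [/\ represents zw.1 u, represents zw.2 v &
    \forall i & j \near \oo, r <= u i ** v j]].

Lemma close_le (r s : R) : r <= s -> close s `<=` close r.
Proof.
rewrite /close => rs [z w] /= [->|[u [v [zu wv H]]]]; first by left.
by right; exists u, v; split=> //; apply: filterS H => -[i j] /=; exact: le_trans.
Qed.

Lemma close_sym (r : R) (z w : B) : close r (z, w) -> close r (w, z).
Proof.
rewrite /close /= => -[->|[u [v [zu wv /near_infty2[N H]]]]]; first by left.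
right; exists v, u; split=> //; apply/near_infty2; exists N => i j Ni Nj.
by rewrite word_productC //; exact: H.
Qed.

Lemma close_trans (r : R) (z w y : B) :
  close (r + delta *+ 2) (z, w) -> close (r + delta *+ 2) (w, y) -> close r (z, y).
Proof.
have rr : r <= r + delta *+ 2 by rewrite lerDl mulrn_wge0.
case=> /= [->|[u [v [zu wv /near_infty2[N H]]]]]; first exact: close_le.
case=> /= [<-|[v' [t [wv' yt /near_infty2[N' H']]]]].
  by right; exists u, v; split=> //; apply/near_infty2; exists N => i j Ni Nj;
    apply: le_trans rr _; exact: H.
right; exists u, t; split=> //; apply/near_infty2.
exists (maxn N N') => i j; rewrite !geq_max => /andP[Ni _] /andP[_ Nj].
rewrite -(addrK (delta *+ 2) r); apply: (represents_trans (N := maxn N N') wv wv').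
  by move=> l; rewrite geq_max => /andP[Nl _]; exact: H.
by move=> l; rewrite geq_max => /andP[_ Nl]; exact: H'.
Qed.

(* [z] lies in [shadow s g] when the geodesics from 1 to [z] follow, up to a
   constant, a geodesic from 1 to [g] for a time [s]. *)
Definition shadow (s : R) (g : G) : set B :=
  [set z | exists2 u, represents z u & \forall i \near \oo, s <= u i ** g].

Lemma shadow_inl (s : R) (g h : G) : shadow s g (inl h) <-> s <= h ** g.
Proof.
split=> [[_ -> /near_infty1[N /(_ N (leqnn N))]]|H] //.
by exists (cst h) => //; apply/near_infty1; exists 0%N.
Qed.

Lemma close_shadow (s : R) (g : G) (z w : B) :
  shadow s g z -> close s (z, w) -> shadow (s - delta *+ 2) g w.
Proof.
move=> [u zu /near_infty1[N H]]; case=> /= [<-|[v [t [zv wt /near_infty2[M H']]]]].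
  exists u => //; apply/near_infty1; exists N => i Ni; apply: le_trans (H i Ni).
  by rewrite lerBlDr lerDl mulrn_wge0.
exists t => //; apply/near_infty1; exists M => j Mj.
apply: (represents_trans (N := maxn M N) zv zu) => i; rewrite geq_max => /andP[Mi Ni].
  by rewrite word_productC //; exact: H'.
exact: H.
Qed.

(** Compactness: take geodesics from 1 to the terms of a sequence converging to [xi]. Their points
    at time [n] range over a finite ball, so along an ultrafilter they are constant, equal to
    [r n]. *)
Lemma geodesic_ray_ex (xi : boundary (word_dist S R)) : finite_set S ->
  exists r : nat -> G, [/\ r 0%N = 1%g, geodesic_ray S r & converges_to r xi].
Proof.
move=> finS; have [w xiw] := represents_ex (inr xi : B).
have winf := converges_to_trans xiw xiw.
have /choice[p Hp] i := word_geodesic genS (w i).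
have [F [UF subF]] := ultraFilterLemma (@eventually_filter).
have PF := @ultra_proper _ _ UF.
have FI P Q : F P -> F Q -> F (P `&` Q) by exact: (@filterI _ _ PF).
have Flen n : F [set i | (n <= len (w i))%N].
  apply: subF; have /product_divergesP/(_ n%:R)[N H] := winf.
  exists N => // i /= Ni; have := H i i Ni Ni.
  by rewrite word_product_self // ler_nat.
have /choice[r Hr] n : exists g, F [set i | p i n = g].
  apply: (ultra_pigeonhole UF (finite_word_ball finS genS n)).
  apply: filterS (Flen n) => i /= ni.
  by have [_ [+ _]] := Hp i n n (introT andP (conj (leqnn n) ni));
    rewrite /word_ball /= => ->.
have geo : geodesic_ray S r.
  move=> m n mn.
  have /filter_ex[i [[/= <- <-] ni]] := FI _ _ (FI _ _ (Hr m) (Hr n)) (Flen n).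
  by have [] := Hp i m n (introT andP (conj mn ni)).
have rw n : F [set i | r n ** w i = n%:R].
  apply: filterS (FI _ _ (Hr n) (Flen n)) => i [/= <- ni].
  have [_ [pn pw]] := Hp i n n (introT andP (conj (leqnn n) ni)).
  by rewrite word_product_geodesic ?pn.
exists r; split=> //.
  have /filter_ex[i /= <-] := Hr 0%N.
  have [_ [p0 _]] := Hp i 0%N 0%N isT.
  exact: (word_length_eq0 genS p0).
have wr : product_diverges (word_dist S R) w r.
  apply/product_divergesP => A; have /product_divergesP/(_ (A + delta))[N HN] := winf.
  pose M := Num.bound `|A + delta|; exists (maxn M N) => i j.
  rewrite !geq_max => /andP[_ Ni] /andP[Mj _].
  have tail : F [set l | (N <= l)%N] by apply: subF; exists N.
  (* A single far term [w l] whose geodesic passes through [r j] links [w i] to [r j]: its product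
     with [r j] is [j]. *)
  have /filter_ex[l [/= Nl rj]] := FI _ _ tail (rw j).
  rewrite -(addrK delta A); apply: (word_product_trans hypG (HN _ _ Ni Nl)).
  rewrite word_productC // rj; apply: le_trans (ler_norm _) _.
  by apply: le_trans (ltW (archi_boundP (normr_ge0 _))) _; rewrite ler_nat.
move: xiw; case: xi => xi [u0 u0inf xiE]; rewrite /= /converges_to /= xiE => -[_ u0w].
split.
  exact: product_diverges_trans (product_diverges_sym wr) wr.
exact: product_diverges_trans u0w wr.
Qed.

End Bordification.

(** * Continuous functions on the bordification *)

Lemma open_bordification (R : realType) (G : groupType) (S : set G)
  (U : set (bordification R S)) : bordification_open U -> open U.
Proof. by []. Qed.

(* A copy of the bordification that carries the uniform structure generated by
   the relations [close r]. Urysohn's construction in this uniform space gives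
   the continuous functions against which weak convergence is tested. The axioms
   hold only under the hypotheses, which are therefore arguments of the type. *)
Definition visual_space (R : realType) (G : groupType) (S : set G) (delta : R)
  (_ : generates S) (_ : 0 <= delta) (_ : delta_hyperbolic (word_dist S R) delta)
  : Type := bordification R S.

Section VisualUniformity.
Context {R : realType} {G : groupType} {S : set G} {delta : R}.
Context (genS : generates S) (delta0 : 0 <= delta).
Context (hypG : delta_hyperbolic (word_dist S R) delta).
Local Notation V := (visual_space genS delta0 hypG).
Local Notation B := (bordification R S).
Local Notation len := (word_length S).
Local Notation "g ** h" := (gromov_product (word_dist S R) 1%g g h)
  (at level 40).

HB.instance Definition _ := Choice.copy V (bordification R S).

Definition visual_entourage : set_system (V * V) := filter_from setT (@close R G S).

Let visual_entourage_filter : Filter visual_entourage.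
Proof.
apply: filter_from_filter; first by exists 0.
move=> r s _ _; exists (Num.max r s) => // zw H.
by split; apply: close_le H; rewrite le_max lexx ?orbT.
Qed.

Let visual_entourage_diagonal A : visual_entourage A -> diagonal `<=` A.
Proof. by case=> r _ sub [z w] zw; apply: sub; left. Qed.

Let visual_entourage_inv A : visual_entourage A -> visual_entourage (A^-1)%relation.
Proof. by case=> r _ sub; exists r => // -[z w] H; apply: sub; exact: close_sym. Qed.

Let visual_entourage_split A : visual_entourage A ->
  exists2 E, visual_entourage E & (E \; E)%relation `<=` A.
Proof.
case=> r _ sub; exists (@close R G S (r + delta *+ 2)); first by exists (r + delta *+ 2).
move=> [z y] [w /= zw wy]; apply: sub; exact: (close_trans genS delta0 hypG zw wy).
Qed.

HB.instance Definition _ := isUniform.Build V visual_entourage_filter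
  visual_entourage_diagonal visual_entourage_inv visual_entourage_split.

(** The sections of the entourages at a boundary point contain the basic neighborhoods of that
    point. Hence functions continuous for the visual uniformity are continuous on the
    bordification. *)
Lemma visual_open (U : set V) : open U -> open (U : set B).
Proof.
move=> oU; apply: open_bordification => xi Uxi.
have : @nbhs V V (inr xi) U by exact: open_nbhs_nbhs.
rewrite -filter_from_entourageE => -[E [r _ rE] EU]; exists r => z Hz.
apply: EU; rewrite /xsection /= inE; apply: rE; right.
case: z Hz => [g|eta] /=.
  move=> [u xiu /near_infty1[N H]]; exists u, (cst g); split=> //.
  by apply/near_infty2; exists N => i j Ni _; exact: H.
by move=> [u [v [xiu etav H]]]; exists u, v.
Qed.

(** A uniform separator is witnessed by a uniform structure with a coarser topology; the visual one
    serves, with entourage [close r]. *)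
Lemma bordification_separator (A C : set B) (r : R) :
  (forall z w, A z -> C w -> ~ close r (z, w)) -> uniform_separator A C.
Proof.
move=> sep; exists (Uniform.class V), (@close R G S r); split.
- by exists r.
- by rewrite -subset0 => -[z w] [[/= Az Cw]]; exact: sep.
- move=> z U; rewrite !nbhsE => -[W [oW Wz] WU]; exists W => //; split=> //.
  exact: visual_open oW.
Qed.

(** By [close_shadow], a point off all the larger shadows is never [close s] to a point of a smaller
    one, so Urysohn's construction separates the two sets. *)
Lemma shadow_bump (F : set G) (s : R) : exists f : B -> R,
  [/\ continuous f, (forall z, 0 <= f z <= 1),
      (forall g z, F g -> shadow s g z -> f z = 1) &
      forall z, (forall g, F g -> ~ shadow (s - delta *+ 2) g z) -> f z = 0].
Proof.
pose A : set B := [set z | forall g, F g -> ~ shadow (s - delta *+ 2) g z].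
pose C : set B := [set z | exists2 g, F g & shadow s g z].
have : uniform_separator A C.
  apply: (@bordification_separator _ _ s) => z w Az [g Fg wg] zw.
  apply: (Az g Fg); apply: (close_shadow genS delta0 hypG wg).
  exact: close_sym.
move=> /(@uniform_separatorP _ R)[f [cf f01 fA fC]]; exists f; split=> //.
- by move=> z; have := f01 _ (imageT f z); rewrite /= in_itv.
- by move=> g z Fg zg; apply: fC; exists z => //; exists g.
- by move=> z Az; apply: fA; exists z.
Qed.

(** Through [xi], the product of [g] and [r n] is at least [n - s] up to [delta *+ 2], because [r n]
    has product [n] with all later points of the ray. Both elements have length [n], so they are
    close. *)
Lemma ray_close_to_shadow (r : nat -> G) (xi : boundary (word_dist S R))
  (g : G) (n m : nat) (s : R) :
  r 0%N = 1%g -> geodesic_ray S r -> converges_to r xi ->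
  len g = n -> 0 <= s -> shadow (n%:R - s) g (inr xi : B) ->
  (s + delta *+ 2) *+ 2 <= m%:R -> (len (g^-1 * r n)%g <= m)%N.
Proof.
move=> r0 geo xir gn s0 [u xiu /near_infty1[N H]] sm.
have rlen i : len (r i) = i by have := geo 0%N i isT; rewrite r0 invg1 mul1g subn0.
apply: (word_product_dist (R := R) (n := n) (r := s + delta *+ 2)) => //.
rewrite opprD addrA.
apply: (represents_trans genS delta0 hypG (z := inr xi : B) (N := maxn N n) xiu xir).
  move=> i; rewrite geq_max => /andP[Ni _].
  by rewrite word_productC //; exact: H.
move=> i; rewrite geq_max => /andP[_ ni].
rewrite word_productC // word_product_geodesic ?rlen //; last exact: geo.
by rewrite lerBlDr lerDl.
Qed.

End VisualUniformity.

Lemma continuous_measurable_bordification (R : realType) (G : groupType)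
    (S : set G) (f : bordification R S -> R) : continuous f ->
  measurable_fun [set: borel_bordification R S]
    (f : borel_bordification R S -> R).
Proof.
move=> /continuousP cf _; apply: (measurability _ (measurable_realfun.RGenOpens.measurableE R)) => //.
move=> _ [_ [a [b ->] <-]]; rewrite setTI; apply: sub_sigma_algebra.
exact/cf/interval_open.
Qed.

(** * From the measure to the spheres *)

Section MassOfShadows.
Context {R : realType} {G : groupType} {S : set G}.
Hypotheses (finS : finite_set S) (genS : generates S).
Context (delta : R) (D : nat).
Hypothesis hypG : delta_hyperbolic (word_dist S R) delta.
Hypothesis deltaD : delta *+ 2 <= D%:R.
Context (lambda c : R).
Hypotheses (lambda1 : 1 < lambda) (c1 : 1 <= c).
Hypothesis growth : forall n : nat,
  c^-1 * lambda ^+ n <= #|` fset_set (word_sphere S n)|%:R <= c * lambda ^+ n.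
Context (k : nat).
Hypothesis few : forall (g : G) (m : nat),
  #|` fset_set [set h | word_sphere S m h /\
    k%:R <= gromov_product (word_dist S R) 1%g g h]|%:R
      <= (2 * c)^-1 * lambda ^+ m.
Local Notation B := (bordification R S).
Local Notation len := (word_length S).
Local Notation ball n := (fset_set (word_ball S n)).

(** The bound holds for the ball averages with [N >= 2 * n] and passes to the weak limit. The
    constant collects [2 * c] from [shadow_union_weight], [c] from [ball_weight_le], and 2 from
    comparing [N + 1] with [N - n + 1]. *)
Lemma card_le_integral (nu : probability (borel_bordification R S) R)
  (A : {fset G}) (n : nat) (f : B -> R) :
  patterson_sullivan lambda nu -> {in A, forall g, len g = n} ->
  continuous f -> (forall z, 0 <= f z <= 1) ->
  (forall g z, g \in A -> shadow (n%:R - k%:R) g z -> f z = 1) ->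
  #|` A|%:R * lambda ^- n <=
    4 * c ^+ 2 * #|` ball (2 * k + D)|%:R * \int[nu]_z f z.
Proof.
move=> [_ PS] An cf f01 fA.
have lambda0 : 0 < lambda by exact: lt_trans ltr01 lambda1.
have c0 : 0 < c by exact: lt_le_trans ltr01 c1.
have w0 g : 0 <= lambda ^- len g by rewrite invr_ge0 exprn_ge0 // ltW.
have /(cvgMl_tmp (a := 4 * c ^+ 2 * #|` ball (2 * k + D)|%:R)) :
    ball_average lambda N f @[N --> \oo] --> (\int[nu]_z f z : R).
  apply: PS => //; exists 1 => z; have /andP[f0 f1] := f01 z.
  by rewrite ger0_norm.
move=> /cvgr_to_ge; apply; apply/near_infty1; exists (2 * n)%N => N nN.
rewrite /ball_average !fsbig_finite; try exact: finite_word_ball.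
rewrite mulrA ler_pdivlMr; last exact: (ball_weight_gt0 finS genS lambda1 c1 growth).
have nN' : (n <= N)%N by lia.
have := shadow_union_weight finS genS hypG deltaD lambda1 c1 growth few An nN'.
set W := (X in _ <= _ * X -> _); set M := #|` ball _|%:R; set a := #|` A|%:R => HW.
set F := (X in _ <= _ * X).
have WF : W <= F.
  rewrite /W /F big_mkcond; apply: ler_sum => z _; case: asboolP => [[g gA zg]|_].
    by rewrite (fA g) ?mulr1 //; apply/shadow_inl.
  by rewrite mulr_ge0 //; case/andP: (f01 (inl z)).
apply: (@le_trans _ _ (4 * c ^+ 2 * (M * W))); last first.
  by rewrite -[leRHS]mulrA ler_wpM2l ?mulr_ge0 ?exprn_ge0 ?(ltW c0) // ler_wpM2l.
apply: (@le_trans _ _ (4 * c ^+ 2 * (a * ((2 * c)^-1 * lambda ^- n * (N - n).+1%:R)))); last first.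
  by rewrite ler_wpM2l ?mulr_ge0 ?exprn_ge0 ?(ltW c0).
have -> : 4 * c ^+ 2 * (a * ((2 * c)^-1 * lambda ^- n * (N - n).+1%:R)) =
    a * lambda ^- n * (c * (2 * (N - n).+1)%:R).
  rewrite natrM; field; rewrite !gt_eqF // exprn_gt0 //.
rewrite ler_wpM2l ?mulr_ge0 ?invr_ge0 ?exprn_ge0 ?(ltW lambda0) //.
apply: (le_trans (ball_weight_le finS genS lambda1 growth N)).
by rewrite ler_pM2l // ler_nat; lia.
Qed.

End MassOfShadows.

Lemma cvg_Rintegral_bounded (d : measure_display) (T : measurableType d)
    (R : realType) (mu : {finite_measure set T -> \bar R}) (f : nat -> T -> R) :
  (forall n, measurable_fun setT (f n)) -> (forall n z, 0 <= f n z <= 1) ->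
  {ae mu, forall z, f n z @[n --> \oo] --> (0 : R)} ->
  \int[mu]_z f n z @[n --> \oo] --> (0 : R).
Proof.
move=> mf f01 f0.
have [] := @dominated_convergence _ T R mu setT measurableT
  (fun n => EFin \o f n) (cst 0%E) (EFin \o cst 1).
- by move=> n; apply/measurable_realfun.measurable_EFinP.
- exact: measurable_cst.
- by apply: filterS f0 => z fz _; apply/fine_cvgP; split=> //; exact: nearW.
- exact: finite_measure_integrable_cst.
- apply: aeW => z n _; rewrite /= lee_fin; have /andP[f0z ?] := f01 n z.
  by rewrite ger0_norm.
by move=> _ _; rewrite integral0; exact: fine_cvg.
Qed.

(** * Orbits in [X] and drift along rays *)

Section Orbit.
Context {R : realType} {G : groupType} {S : set G} {X : metricType R}.
Context (a : G -> X -> X) (isoa : isometric_action a) (x : X).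
Hypotheses (finS : finite_set S) (genS : generates S).
Local Notation len := (word_length S).

(** By invariance the distance from [a g x] to [a h x] is a displacement of [x] by an element of a
    finite ball; the sum over the ball dominates them all. *)
Lemma orbit_bounded (m : nat) : exists C : R, forall g h : G,
  (len (g^-1 * h)%g <= m)%N -> mdist x (a h x) <= mdist x (a g x) + C.
Proof.
have [_ aM aI] := isoa.
exists (\sum_(h <- fset_set (word_ball S m)) mdist x (a h x)) => g h gh.
apply: le_trans (metric_triangle x (a g x) (a h x)) _; rewrite lerD2l.
rewrite -{1}(mulVKg g h) aM aI.
rewrite (big_fsetD1 (g^-1 * h)%g) ?in_word_ball //= lerDl.
by apply: sumr_ge0 => i _; exact: mdist_ge0.
Qed.

End Orbit.

(** If [xi] were in the shadow of such a [g], a ray to [xi] would be near [g] at time [n], and its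
    displacement would be less than [(L - eps) * n + C], too small for drift [L]. *)
Lemma drift_leaves_shadows (R : realType) (G : groupType) (S : set G)
  (X : metricType R) (a : G -> X -> X) (isoa : isometric_action a) (x : X)
  (finS : finite_set S) (genS : generates S) (delta : R) (delta0 : 0 <= delta)
  (hypG : delta_hyperbolic (word_dist S R) delta)
  (xi : boundary (word_dist S R)) (L eps s : R) : 0 < eps -> 0 <= s ->
  (forall r : nat -> G, geodesic_ray S r -> converges_to r xi ->
    mdist x (a (r n) x) / n%:R @[n --> \oo] --> L) ->
  \forall n \near \oo, forall g, word_length S g = n ->
    mdist (a g x) x < (L - eps) * n%:R -> ~ shadow (n%:R - s) g (inr xi).
Proof.
move=> eps0 s0 dr.
have [r [r0 geo xir]] := geodesic_ray_ex genS hypG xi finS.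
have [C HC] := orbit_bounded isoa x finS genS (Num.bound `|(s + delta *+ 2) *+ 2|).
(* One half of [eps] is left to the convergence of the drift; the other absorbs [C] once
   [n > 2 * C / eps]. *)
have half0 : L - eps / 2 < L by rewrite ltrBlDr ltrDl divr_gt0.
have := cvgr_gt _ (dr r geo xir) _ half0 => -[N _ HN].
have := nbhs_infty_gtr (2 * C / eps) => -[M _ HM].
apply/near_infty1; exists (maxn 1 (maxn N M)) => n.
rewrite !geq_max => /and3P[n1 Nn Mn] g gn bad gxi.
have := HC g (r n) (ray_close_to_shadow genS delta0 hypG r0 geo xir gn s0 gxi _).
move=> /(_ (le_trans (ler_norm _) (ltW (archi_boundP (normr_ge0 _))))).
have n0 : 0 < n%:R :> R by rewrite ltr0n.
have := HN n Nn; have := HM n Mn; rewrite ltr_pdivrMr // ltr_pdivlMr //.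
by rewrite metric_sym in bad; nra.
Qed.

Theorem theorem7p3 (R : realType) (G : groupType) (S : set G)
  (finS : finite_set S) (genS : generates S) (hypG : hyperbolic_group S R)
  (X : metricType R) (sepX : separable_space X) (hypX : hyperbolic_space X)
  (a : G -> X -> X) (isoa : isometric_action a) (nonel : nonelementary a)
  (lambda : R) (growth : growth_rate S lambda)
  (nu : probability (borel_bordification R S) R)
  (PS : patterson_sullivan lambda nu)
  (L : R) (drift : drift_constant a nu L) (x : X) (eps : R) (eps0 : 0 < eps) :
  #|` fset_set [set g | word_sphere S n g /\
        mdist (a g x) x >= (L - eps) * (word_length S g)%:R]|%:R
    / #|` fset_set (word_sphere S n)|%:R @[n --> \oo] --> (1 : R).
Proof.
have [delta delta0 hypd] := hypG.
have [lambda1 [c c1 gr]] := growth.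
pose D := Num.bound `|delta *+ 2|.
have deltaD : delta *+ 2 <= D%:R.
  exact: le_trans (ler_norm _) (ltW (archi_boundP (normr_ge0 _))).
have [k few] := card_fellow_travelers finS genS hypd deltaD lambda1 c1 gr.
pose bad n : set G := [set g | word_length S g = n /\
  mdist (a g x) x < (L - eps) * n%:R].
have finbad n : finite_set (bad n).
  by apply: sub_finite_set (finite_word_sphere finS genS n) => g [].
have /choice[f Hf] n := shadow_bump genS delta0 hypd (bad n) (n%:R - k%:R).
have f_to0 : \int[nu]_z f n z @[n --> \oo] --> (0 : R).
  apply: cvg_Rintegral_bounded => [n|n z|].
  - by apply: continuous_measurable_bordification; have [] := Hf n.
  - by have [] := Hf n.
  have [nu0 _] := PS; have [_ /(_ x) driftx] := drift.
  (* [range inl] is open, hence measurable, because openness is a condition at boundary points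
     only. *)
  have inl0 : {ae nu, forall z, ~ range inl z}.
    apply/negligibleP; last by rewrite setCK.
    by rewrite setCK; apply: sub_sigma_algebra; apply: open_bordification => xi [].
  apply: (@filterS2 _ _ (ae_filter_ringOfSetsType nu) _ _ _ _ inl0 driftx) =>
    -[g []|xi _ /(_ xi erefl) dr]; first by exists g.
  (* At a boundary point with drift [L], [f n] is exactly 0 for large [n]: the point has left the
     larger shadows, whose margin is [k + 2 * delta]. *)
  apply: cvg_near_cst.
  have s0 : 0 <= k%:R + delta *+ 2 by rewrite addr_ge0 ?mulrn_wge0.
  apply: filterS (drift_leaves_shadows isoa finS genS delta0 hypd eps0 s0 dr) => n Hn.
  have [_ _ _] := Hf n; apply => g [gn gbad].
  by rewrite -addrA -opprD; exact: Hn.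
have c0 : 0 < c by exact: lt_le_trans ltr01 c1.
have lamX n : 0 < lambda ^+ n by rewrite exprn_gt0 // (lt_trans ltr01).
have sphere0 n : 0 < #|` fset_set (word_sphere S n)|%:R :> R.
  by apply: lt_le_trans (proj1 (andP (gr n))); rewrite mulr_gt0 ?invr_gt0.
pose M : R := 4 * c ^+ 2 * #|` fset_set (word_ball S (2 * k + D))|%:R.
have bad_to0 : #|` fset_set (bad n)|%:R / #|` fset_set (word_sphere S n)|%:R
    @[n --> \oo] --> (0 : R).
  (* The extra factor [c] comes from replacing [lambda ^+ n] by the cardinality of the sphere. *)
  have := cvgMl_tmp (a := c * M) f_to0; rewrite mulr0 => cM0.
  apply: (squeeze_cvgr (f := fun=> 0)); [|exact: cvg_cst|exact: cM0]; apply: nearW => n.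
  have [cf f01 fbad _] := Hf n.
  have inbad g : g \in fset_set (bad n) -> bad n g by rewrite in_fset_set // inE.
  have := card_le_integral finS genS hypd deltaD lambda1 c1 gr few PS
    (fun g gA => proj1 (inbad g gA)) cf f01 (fun g z gA => fbad g z (inbad g gA)).
  rewrite -/M; set b := #|` fset_set (bad n)|%:R; set I := Rintegral _ _ _ => H.
  rewrite divr_ge0 //= -mulrA (le_trans _ (ler_wpM2l (ltW c0) H)) //.
  rewrite mulrCA ler_wpM2l // -[leRHS]invrK lef_pV2 ?posrE ?invr_gt0 ?mulr_gt0 //.
    by rewrite invfM invrK; case/andP: (gr n).
  by rewrite invr_gt0.
have -> : (fun n => #|` fset_set [set g | word_sphere S n g /\
    mdist (a g x) x >= (L - eps) * (word_length S g)%:R]|%:R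
      / #|` fset_set (word_sphere S n)|%:R) =
    (fun n => 1 - #|` fset_set (bad n)|%:R / #|` fset_set (word_sphere S n)|%:R :> R).
  apply/funext => n; set good := [set g | _].
  have fing : finite_set good.
    by apply: sub_finite_set (finite_word_sphere finS genS n) => g [].
  have sphereE : word_sphere S n = good `|` bad n.
    rewrite eqEsubset; split=> [g gn|g [[]|[]] //].
    have [H|H] := lerP ((L - eps) * (word_length S g)%:R) (mdist (a g x) x).
      by left.
    by right; split=> //; rewrite -gn.
  have goodbad0 : good `&` bad n = set0.
    rewrite -subset0 => g [[gn +] [_]]; rewrite gn => H1 H2.
    by have := le_lt_trans H1 H2; rewrite ltxx.
  have cardE : #|` fset_set (word_sphere S n)|%:R =
      #|` fset_set good|%:R + #|` fset_set (bad n)|%:R :> R.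
    by rewrite sphereE fset_setU // cardfsU -fset_setI // goodbad0 fset_set0
      cardfs0 subn0 natrD.
  by rewrite -[LHS](addrK (#|` fset_set (bad n)|%:R / #|` fset_set (word_sphere S n)|%:R))
    -mulrDl -cardE mulfV // gt_eqF.
rewrite -[X in _ --> X](subr0 (1 : R)).
by apply: cvgB; [exact: cvg_cst|exact: bad_to0].
Qed.
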